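(* (i) Let $n\ge 2$ and $d\ge 1$ be integers, let $r(z,\bar z)$ be a real polynomial on $\mathbb{C}^n$, not identically zero, such that $r(z,\bar z)\,\|z\|^{2d}$ is a squared norm, and let $(N_+,N_-)$ be the signature pair of $r$. Then $$\frac{N_-}{N_+}\le\binom{n-1+d}{d}-1.$$ (ii) For each fixed $n\ge 2$ there exists a constant $C_n>0$ such that for each integer $d\ge 1$ there is a polynomial $r\in\Psi_d$ on $\mathbb{C}^n$, not identically zero, whose signature pair $(N_+,N_-)$ satisfies $$\frac{N_-}{N_+}\ge C_n\,d^{\,n-1}.$$
   Context: A real polynomial on $\mathbb{C}^n$ is a real-valued polynomial $r(z,\bar z)=\sum_{\alpha,\beta}c_{\alpha\beta}z^\alpha\bar z^\beta$ in $z$ and $\bar z$, where $z\in\mathbb{C}^n$ (so the coefficient matrix $(c_{\alpha\beta})$ is Hermitian). Here $\|z\|^{2d}=\bigl(\sum_{k=1}^n|z_k|^2\bigr)^d$. A squared norm (also called a Hermitian sum of squares) is a polynomial of the form $\|f(z)\|^2=\sum_{j=1}^N|f_j(z)|^2$ with finitely many holomorphic polynomials $f_j$ (that is, $f_j\in\mathbb{C}[z_1,\dots,z_n]$). Every real polynomial can be written as $r(z,\bar z)=\sum_{j=1}^{N_+}|f_j(z)|^2-\sum_{j=1}^{N_-}|g_j(z)|^2$ with holomorphic polynomials $f_j,g_j$; when $f_1,\dots,f_{N_+},g_1,\dots,g_{N_-}$ are linearly independent, the pair $(N_+,N_-)$ is uniquely determined by $r$ and is called the signature pair of $r$. Equivalently,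 $N_+$ and $N_-$ are the numbers of positive and negative eigenvalues of the Hermitian coefficient matrix $(c_{\alpha\beta})$. A real polynomial is bihomogeneous if it has the form $r(z,\bar z)=\sum_{|\alpha|=|\beta|=m}c_{\alpha\beta}z^\alpha\bar z^\beta$ for some $m\ge 0$. $\Psi_d$ denotes the set of bihomogeneous real polynomials $r$ on $\mathbb{C}^n$ such that $r(z,\bar z)\|z\|^{2d}$ is a Hermitian sum of squares. *)

(* Defs.v *)
From HB Require Import structures.
From mathcomp Require Import all_boot all_order all_algebra.
From mathcomp Require Import complex.
From mathcomp Require Import mpoly.
From mathcomp Require Import reals.
Set Implicit Arguments.
Unset Strict Implicit.
Unset Printing Implicit Defensive.

Import Order.TTheory GRing.Theory Num.Theory.

Local Open Scope ring_scope.

(* A polynomial in z and zbar is an element of {mpoly R[i][n + n]}: the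
   variables [lshift n k] stand for z_k and [rshift n k] for the conjugate of
   z_k, so that c_(alpha, beta) is the coefficient of the concatenated
   multi-index (alpha, beta). *)
Definition zzbar (R : realType) (n : nat) (z : 'I_n -> R[i]) :
    'I_(n + n) -> R[i] :=
  fun i => match split i with inl k => z k | inr k => Num.conj (z k) end.

Definition heval (R : realType) (n : nat) (r : {mpoly R[i][n + n]})
    (z : 'I_n -> R[i]) : R[i] :=
  r.@[zzbar z].

Definition real_poly (R : realType) (n : nat) (r : {mpoly R[i][n + n]}) : Prop :=
  forall z : 'I_n -> R[i], heval r z \is Num.real.

Definition normsq (R : realType) (n : nat) : {mpoly R[i][n + n]} :=
  \sum_(k < n) 'X_(lshift n k) * 'X_(rshift n k).

Lemma heval_normsq (R : realType) (n : nat) (z : 'I_n -> R[i]) :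
  heval (normsq R n) z = \sum_(k < n) `|z k| ^+ 2.
Proof.
rewrite /heval /normsq raddf_sum /=; apply: eq_bigr => k _.
rewrite mevalM !mevalXU /zzbar.
by rewrite (unsplitK (inl k)) (unsplitK (inr k)) normCK.
Qed.

Definition squared_norm (R : realType) (n : nat) (p : {mpoly R[i][n + n]}) : Prop :=
  exists (N : nat) (f : 'I_N -> {mpoly R[i][n]}),
    forall z : 'I_n -> R[i], heval p z = \sum_(j < N) `|(f j).@[z]| ^+ 2.

Definition lin_indep (K : fieldType) (V : lmodType K) (I : finType)
    (v : I -> V) : Prop :=
  forall a : I -> K, \sum_i a i *: v i = 0 -> forall i, a i = 0.

(* A relation rather than a function: by linear independence (Sylvester's law
   of inertia) at most one pair (Np, Nm) satisfies it for a given r. *)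
Definition signature_pair (R : realType) (n : nat) (r : {mpoly R[i][n + n]})
    (Np Nm : nat) : Prop :=
  exists (f : 'I_Np -> {mpoly R[i][n]}) (g : 'I_Nm -> {mpoly R[i][n]}),
    lin_indep (fun i : 'I_Np + 'I_Nm =>
                 match i with inl j => f j | inr j => g j end) /\
    forall z : 'I_n -> R[i],
      heval r z =
      \sum_(j < Np) `|(f j).@[z]| ^+ 2 - \sum_(j < Nm) `|(g j).@[z]| ^+ 2.

Definition bihomogeneous (R : realType) (n : nat) (r : {mpoly R[i][n + n]}) : Prop :=
  exists m : nat, forall ab : 'X_{1..n + n}, ab \in msupp r ->
    (\sum_(k < n) ab (lshift n k) = m)%N /\ (\sum_(k < n) ab (rshift n k) = m)%N.

Definition Psi (R : realType) (n d : nat) (r : {mpoly R[i][n + n]}) : Prop :=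
  [/\ real_poly r, bihomogeneous r & squared_norm (r * normsq R n ^+ d)].

(* Main.v *)
(* (i) Write r = |f|^2 - |g|^2 and r |z|^(2d) = |h|^2. Polarizing
   |f (x) z^d|^2 = |g (x) z^d|^2 + |h|^2 puts every g_j z^b with |b| = d in the
   span of the products f_i z^b'. For one fixed b, the N_+ + N_- independent
   polynomials f_i z^b, g_j z^b thus lie in a space of dimension at most
   N_+ binom(n-1+d, d).
   (ii) Take the diagonal form r = sum_(a in A) |z^a|^2 - e sum_(b in B) |z^b|^2,
   where A and B partition the monomials of degree m. If every monomial of
   degree m + d is divisible by one in A, then r |z|^(2d) has nonnegative
   coefficients for small e > 0. By pigeonhole A = {z_1^m, ..., z_n^m} works as
   soon as n (m - 1) <= d, and then N_-/N_+ grows like d^(n-1). *)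
Require Import Defs.
From HB Require Import structures.
From mathcomp Require Import all_boot all_order all_algebra.
From mathcomp Require Import complex.
From mathcomp Require Import mpoly.
From mathcomp Require Import reals.
From mathcomp Require Import zify.
Set Implicit Arguments.
Unset Strict Implicit.
Unset Printing Implicit Defensive.

Import Order.TTheory GRing.Theory Num.Theory.

Local Open Scope ring_scope.

(** * Polynomials determined by their values at special points *)

(** Reduction modulo [B] isolates digit 0 and division by [B] shifts the other digits down, which
    drives the induction on [n]. *)
Lemma digits_inj (B : nat) (f g : nat -> nat) (n : nat) :
  (forall i, i < n -> f i < B)%N -> (forall i, i < n -> g i < B)%N ->
  (\sum_(i < n) f i * B ^ i = \sum_(i < n) g i * B ^ i)%N ->
  forall i, (i < n)%N -> f i = g i.
Proof.
elim: n f g => [//|n IHn] f g fB gB.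
have shift (h : nat -> nat) : (\sum_(i < n.+1) h i * B ^ i =
    (\sum_(i < n) h i.+1 * B ^ i) * B + h 0)%N.
  rewrite big_ord_recl expn0 muln1 addnC; congr (_ + _)%N.
  by rewrite big_distrl; apply: eq_bigr => i _; rewrite /= expnSr mulnA.
rewrite !shift => E; have B0 : (0 < B)%N by exact: leq_ltn_trans (fB 0%N _).
have E0 : f 0%N = g 0%N.
  by move/(congr1 (modn^~ B)): E; rewrite !modnMDl !modn_small ?fB ?gB.
have /(IHn (f \o S) (g \o S)) E1 : (\sum_(i < n) f i.+1 * B ^ i =
    \sum_(i < n) g i.+1 * B ^ i)%N.
  move/(congr1 (divn^~ B)): E.
  by rewrite !divnMDl // !divn_small ?fB ?gB // !addn0.
by case=> [//|i] /E1; apply=> j ?; [apply: fB | apply: gB].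
Qed.

(** In characteristic zero the first [size p] naturals are distinct, one root more than a nonzero
    [p] can have. *)
Lemma poly_nat_roots_eq0 (K : numDomainType) (p : {poly K}) :
  (forall k : nat, p.[k%:R] = 0) -> p = 0.
Proof.
move=> p0; apply/eqP/negPn/negP => pN0.
suff : (size [seq i%:R : K | i <- iota 0 (size p)] < size p)%N.
  by rewrite size_map size_iota ltnn.
apply: max_poly_roots => //.
  by apply/allP => x /mapP[k _ ->]; rewrite /root p0.
by rewrite map_inj_uniq ?iota_uniq // => i j /eqP; rewrite eqr_nat => /eqP.
Qed.

(* Kronecker substitution [X_i := X^(B^i)], with [B] larger than every
   exponent, turns distinct monomials of [p] into distinct powers of [X]. *)
Lemma mpoly_nat_roots_eq0 (K : numDomainType) (n : nat) (p : {mpoly K[n]}) :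
  (forall v : 'I_n -> nat, p.@[fun i => (v i)%:R] = 0) -> p = 0.
Proof.
move=> p0; pose B := msize p.
pose e (m : 'X_{1..n}) := (\sum_(i < n) m i * B ^ i)%N.
have e_inj m m' : m \in msupp p -> m' \in msupp p -> e m = e m' -> m = m'.
  have lt_B m0 (i : nat) : m0 \in msupp p -> (i < n)%N -> (nth 0 m0 i < B)%N.
    move=> m0p ltin; apply: leq_ltn_trans (msize_mdeg_lt m0p).
    by rewrite mdegE (bigD1 (Ordinal ltin)) //= (mnm_nth 0%N) leq_addr.
  move=> mp m'p; rewrite /e => E; apply/mnmP => i; rewrite !(mnm_nth 0%N).
  apply: (@digits_inj B (nth 0%N m) (nth 0%N m') n) => //.
  - by move=> j; apply: lt_B.
  - by move=> j; apply: lt_B.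
  by rewrite -[LHS](eq_bigr _ (fun i _ => congr1 (muln^~ _) (mnm_nth 0%N m i))) E;
    apply: eq_bigr => j _; rewrite (mnm_nth 0%N).
pose q := \sum_(m <- msupp p) p@_m *: 'X^(e m) : {poly K}.
have q0 : q = 0.
  apply: poly_nat_roots_eq0 => k.
  (* The value of [q] at [k] is that of [p] at the natural point with coordinates [k ^ (B ^ i)]. *)
  rewrite -[RHS](p0 (fun i => k ^ (B ^ i))%N) mevalE horner_sum.
  apply: eq_bigr => m _; rewrite hornerZ hornerXn /e; congr (_ * _).
  rewrite expr_sum; apply: eq_bigr => i _.
  by rewrite mulnC exprM natrX.
apply/mpolyP => m; rewrite mcoeff0; apply/eqP.
rewrite mcoeff_eq0; apply/negP => mp.
have := congr1 (fun r : {poly K} => r`_(e m)) q0.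
rewrite coef0 coef_sum (bigD1_seq m) //= big_seq_cond big1 ?addr0.
  by rewrite coefZ coefXn eqxx mulr1 => /eqP; rewrite mcoeff_eq0 mp.
move=> m' /andP[m'p m'm]; rewrite coefZ coefXn.
case: eqP => [/e_inj E|_]; last by rewrite mulr0.
by rewrite E ?eqxx in m'm.
Qed.

Lemma mpoly_eval_inj (K : numDomainType) (n : nat) (p q : {mpoly K[n]}) :
  (forall v, p.@[v] = q.@[v]) -> p = q.
Proof.
move=> pq; apply/eqP; rewrite -subr_eq0; apply/eqP.
by apply: mpoly_nat_roots_eq0 => v; rewrite mevalB pq subrr.
Qed.

(* Substituting [z := x + iy] reduces to vanishing at natural numbers [x], [y]. *)
Lemma mpoly_conj_roots_eq0 (C : numClosedFieldType) (n : nat)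
    (p : {mpoly C[n + n]}) :
  (forall z : 'I_n -> C,
     p.@[fun k => match split k with inl j => z j | inr j => (z j)^* end] = 0) ->
  p = 0.
Proof.
move=> p0; pose i : C := 'i.
pose lq := [tuple match split k with
  | inl j => 'X_(lshift n j) + i *: 'X_(rshift n j)
  | inr j => 'X_(lshift n j) - i *: 'X_(rshift n j) end | k < n + n]
  : (n + n).-tuple {mpoly C[n + n]}.
have q0 : p \mPo lq = 0.
  apply: mpoly_nat_roots_eq0 => v.
  pose z k : C := (v (lshift n k))%:R + i * (v (rshift n k))%:R.
  rewrite comp_mpoly_meval -[RHS](p0 z).
  apply: meval_eq => k; rewrite tnth_mktuple.
  case: split => j; rewrite ?mevalB ?mevalD mevalZ !mevalXU //.
  by rewrite rmorphD rmorphM /= !rmorph_nat conjCi mulNr.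
apply: mpoly_eval_inj => w; rewrite meval0.
(* Solving for x and y inverts [lq] at an arbitrary [w], whose two blocks need not be conjugate. *)
pose v k := match split k with
  | inl j => (w (lshift n j) + w (rshift n j)) / 2
  | inr j => (w (lshift n j) - w (rshift n j)) / (2 * i) end.
have := congr1 (meval v) q0; rewrite comp_mpoly_meval meval0 => <-.
apply: meval_eq => k; rewrite tnth_mktuple.
have i0 : i != 0 := neq0Ci _.
have half (a b : C) : (a + b + (a - b)) / 2 = a.
  by rewrite addrACA subrr addr0 -mulr2n -[_ *+ 2]mulr_natr mulfK ?pnatr_eq0.
have iK (u : C) : i * (u / (2 * i)) = u / 2.
  by rewrite invfM mulrCA [i * _]mulrCA divff // mulr1.
have s u : split (lshift n u) = inl u :> 'I_n + 'I_n := unsplitK (inl u).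
have s' u : split (rshift n u) = inr u :> 'I_n + 'I_n := unsplitK (inr u).
case: splitP => j jk; rewrite ?mevalB ?mevalD mevalZ !mevalXU /v s s';
  rewrite iK -?mulrBl -?mulrDl.
  have -> : k = lshift n j by apply: val_inj.
  exact/esym/half.
have -> : k = rshift n j by apply: val_inj.
by rewrite opprB [w _ + w _]addrC; exact/esym/half.
Qed.

Lemma heval_eq0 (R : realType) (n : nat) (p : {mpoly R[i][n + n]}) :
  (forall z, heval p z = 0) -> p = 0.
Proof. exact: mpoly_conj_roots_eq0. Qed.

(** * Polarization and linear spans *)

Lemma meval_sum (K : comNzRingType) (n : nat) (I : Type) (s : seq I) (P : pred I)
    (F : I -> {mpoly K[n]}) (v : 'I_n -> K) :
  (\sum_(i <- s | P i) F i).@[v] = \sum_(i <- s | P i) (F i).@[v].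
Proof. exact: raddf_sum. Qed.

Lemma meval_conj (C : numClosedFieldType) (n : nat) (p : {mpoly C[n]})
    (w : 'I_n -> C) :
  (map_mpoly Num.conj p).@[fun j => (w j)^*] = (p.@[w])^*.
Proof.
rewrite (map_mpolyE _ (leqnn (msize p))) [in RHS](mpolywE (leqnn (msize p))).
rewrite !meval_sum rmorph_sum /=; apply: eq_bigr => m _.
rewrite mevalZ mevalX mevalZ mevalX rmorphM rmorph_prod; congr (_ * _).
by apply: eq_bigr => k _; rewrite rmorphXn.
Qed.

(** Conjugating coefficients turns both sides into polynomials in z and the conjugate of w. Their
    difference vanishes for w = z, that is, on all pairs of conjugate blocks, hence identically. *)
Lemma polarization (C : numClosedFieldType) (n : nat) (I J : finType)
    (F : I -> {mpoly C[n]}) (G : J -> {mpoly C[n]}) :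
  (forall z, \sum_i `|(F i).@[z]| ^+ 2 = \sum_j `|(G j).@[z]| ^+ 2) ->
  forall z w, \sum_i (F i).@[z] * ((F i).@[w])^* =
              \sum_j (G j).@[z] * ((G j).@[w])^*.
Proof.
move=> FG z w.
pose pol (p : {mpoly C[n]}) : {mpoly C[n + n]} :=
  (p \mPo [tuple 'X_(lshift n k) | k < n]) *
  (map_mpoly Num.conj p \mPo [tuple 'X_(rshift n k) | k < n]).
pose pt (x y : 'I_n -> C) (k : 'I_(n + n)) :=
  match split k with inl j => x j | inr j => (y j)^* end.
have polE p x y : (pol p).@[pt x y] = p.@[x] * (p.@[y])^*.
  rewrite mevalM !comp_mpoly_meval -meval_conj; congr (_ * _);
    apply: meval_eq => k; rewrite tnth_mktuple mevalXU /pt.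
    by rewrite (unsplitK (inl k)).
  by rewrite (unsplitK (inr k)).
have P0 : \sum_i pol (F i) - \sum_j pol (G j) = 0.
  apply: mpoly_conj_roots_eq0 => x; rewrite -/(pt x x).
  rewrite mevalB !meval_sum; apply/eqP; rewrite subr_eq0; apply/eqP.
  under eq_bigr do rewrite polE -normCK.
  under [RHS]eq_bigr do rewrite polE -normCK.
  exact: FG.
have /eqP := congr1 (meval (pt z w)) P0.
rewrite mevalB !meval_sum meval0 subr_eq0 => /eqP E.
under eq_bigr do rewrite -polE.
by under [RHS]eq_bigr do rewrite -polE.
Qed.

(** Coefficients are extracted in z for fixed w, then in w; conjugation in between ([flip]) makes w
    the holomorphic variable. *)
Lemma coef_polarization (C : numClosedFieldType) (n : nat) (I J : finType)
    (F : I -> {mpoly C[n]}) (G : J -> {mpoly C[n]}) :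
  (forall z, \sum_i `|(F i).@[z]| ^+ 2 = \sum_j `|(G j).@[z]| ^+ 2) ->
  forall a b, \sum_i (F i)@_a * ((F i)@_b)^* = \sum_j (G j)@_a * ((G j)@_b)^*.
Proof.
move=> /polarization FG a b.
have scaled (L : finType) (H : L -> {mpoly C[n]}) (c : L -> C) (m : 'X_{1..n}) :
    (\sum_l c l *: H l)@_m = \sum_l (H l)@_m * c l.
  by rewrite raddf_sum; apply: eq_bigr => l _; rewrite /= mcoeffZ mulrC.
have evaled (L : finType) (H : L -> {mpoly C[n]}) (c : L -> C) v :
    (\sum_l c l *: H l).@[v] = \sum_l (H l).@[v] * c l.
  by rewrite meval_sum; apply: eq_bigr => l _; rewrite mevalZ mulrC.
have E1 w : \sum_i ((F i).@[w])^* *: F i = \sum_j ((G j).@[w])^* *: G j.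
  by apply: mpoly_eval_inj => z; rewrite !evaled FG.
have flip (L : finType) (x y : L -> C) :
    \sum_l x l * (y l)^* = (\sum_l y l * (x l)^*)^*.
  rewrite rmorph_sum; apply: eq_bigr => l _.
  by rewrite rmorphM /= conjCK mulrC.
have E2 : \sum_i ((F i)@_b)^* *: F i = \sum_j ((G j)@_b)^* *: G j.
  apply: mpoly_eval_inj => w; rewrite !evaled [LHS]flip [RHS]flip.
  by have := congr1 (mcoeff b) (E1 w); rewrite !scaled => ->.
by have := congr1 (mcoeff a) E2; rewrite !scaled.
Qed.

(* A linear functional [x] on coefficients killing every [F i] satisfies
   [\sum_j |x (G j)|^2 = \sum_i |x (F i)|^2 = 0], hence kills every [G j]. *)
Lemma sum_normsq_span (C : numClosedFieldType) (n : nat) (I J : finType)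
    (F : I -> {mpoly C[n]}) (G : J -> {mpoly C[n]}) :
  (forall z, \sum_i `|(F i).@[z]| ^+ 2 = \sum_j `|(G j).@[z]| ^+ 2) ->
  forall j, exists a : I -> C, G j = \sum_i a i *: F i.
Proof.
move=> /coef_polarization FG.
(* All supports lie in degrees below [k], so a row of [mx] records every coefficient of its
   polynomial. *)
pose k := maxn (\max_i msize (F i)) (\max_j msize (G j)).
pose T : finType := 'X_{1..n < k}.
pose mx (L : finType) (H : L -> {mpoly C[n]}) :=
  \matrix_(l < #|L|, t < #|T|) (H (enum_val l))@_(enum_val t : 'X_{1..n < k}).
(* The squared values of a functional, summed over the family, depend only on the sums that
   [coef_polarization] equates. *)
have norm_func (L : finType) (H : L -> {mpoly C[n]}) (x : 'I_#|T| -> C) :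
    \sum_l `|\sum_t (mx L H) (enum_rank l) t * x t| ^+ 2 =
    \sum_s \sum_t x s * (x t)^* * \sum_l (H l)@_(enum_val s : 'X_{1..n < k})
      * ((H l)@_(enum_val t : 'X_{1..n < k}))^*.
  under [RHS]eq_bigr => s _ do under eq_bigr => t _ do rewrite mulr_sumr.
  under [RHS]eq_bigr => s _ do rewrite exchange_big.
  rewrite [RHS]exchange_big; apply: eq_bigr => l _ /=.
  rewrite normCK rmorph_sum mulr_suml.
  apply: eq_bigr => s _; rewrite mulr_sumr; apply: eq_bigr => t _.
  by rewrite !mxE !enum_rankK rmorphM /= mulrACA mulrC.
(* Each column of the cokernel matrix is a functional killing all [F i]; once it kills all [G j],
   row space inclusion follows. *)
have GK0 : mx J G *m cokermx (mx I F) = 0.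
  apply/matrixP => j c; rewrite [RHS]mxE.
  pose x t := (cokermx (mx I F)) t c.
  have Fx0 : \sum_l `|\sum_t (mx I F) (enum_rank l) t * x t| ^+ 2 = 0.
    apply: big1 => i _; have /matrixP/(_ (enum_rank i) c) := mulmx_coker (mx I F).
    by rewrite !mxE => ->; rewrite normr0 expr0n.
  move: Fx0; rewrite norm_func.
  under eq_bigr => s _ do under eq_bigr => t _ do rewrite FG.
  rewrite -norm_func => /psumr_eq0P Gx0.
  have /eqP := Gx0 (fun _ _ => exprn_ge0 _ (normr_ge0 _)) (enum_val j) isT.
  rewrite enum_valK.
  by rewrite expf_eq0 /= normr_eq0 => /eqP <-; rewrite mxE.
have /submxP[D GD] : (mx J G <= mx I F)%MS by rewrite submxE GK0.
move=> j; exists (fun i => D (enum_rank j) (enum_rank i)).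
have coef_eq0 p m : (msize p <= k)%N -> (k <= mdeg m)%N -> p@_m = 0.
  move=> pk km; apply/eqP; rewrite mcoeff_eq0; apply/negP => /msize_mdeg_lt.
  by rewrite ltnNge (leq_trans pk km).
apply/mpolyP => m; rewrite raddf_sum /=.
have [mk|km] := ltnP (mdeg m) k; last first.
  rewrite coef_eq0 //; last by rewrite leq_max (leq_bigmax j) orbT.
  rewrite big1 // => i _.
  by rewrite mcoeffZ coef_eq0 ?mulr0 // leq_max (leq_bigmax i).
have /matrixP/(_ (enum_rank j) (enum_rank (BMultinom mk : T))) := GD.
rewrite !mxE !enum_rankK /= => ->.
rewrite (reindex (@enum_rank I)) /=; last by apply: onW_bij; apply: enum_rank_bij.
by apply: eq_bigr => i _; rewrite mxE !enum_rankK mcoeffZ.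
Qed.

(** Expressing [v] through [w] gives a matrix whose left kernel consists of linear relations among
    the [v i]. Independence makes it row free, so its rank is [#|I|], bounded by its [#|J|]
    columns. *)
Lemma lin_indep_card (K : fieldType) (V : lmodType K) (I J : finType)
    (v : I -> V) (w : J -> V) :
  lin_indep v -> (forall i, exists a : J -> K, v i = \sum_j a j *: w j) ->
  (#|I| <= #|J|)%N.
Proof.
move=> v_free /fin_all_exists[a va].
pose A := \matrix_(i < #|I|, j < #|J|) a (enum_val i) (enum_val j).
suff <- : \rank A = #|I| by apply: rank_leq_col.
apply/eqP; rewrite -/(row_free A) -kermx_eq0; apply/eqP/row_matrixP => i0.
rewrite row0; set x := row _ _.
have xA : x *m A = 0 by rewrite /x -row_mul mulmx_ker row0.
have x0 : \sum_i x 0 (enum_rank i) *: v i = 0.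
  under eq_bigr => i _ do rewrite va scaler_sumr.
  rewrite exchange_big big1 // => j _.
  under eq_bigr do rewrite scalerA.
  rewrite -scaler_suml; have /matrixP/(_ 0 (enum_rank j)) := xA.
  rewrite !mxE (reindex (@enum_rank I)) /=; last first.
    by apply: onW_bij; apply: enum_rank_bij.
  by under eq_bigr do rewrite [A _ _]mxE !enum_rankK; move=> ->; rewrite scale0r.
apply/rowP => i; rewrite [RHS]mxE -(v_free _ x0 (enum_val i)).
by rewrite enum_valK.
Qed.

(** * Monomials of fixed degree and multinomial coefficients *)

(** [basis n d] consists of the sorted [d]-tuples of variable indices, so each multi-index of degree
    [d] is listed exactly once. *)
Definition monomials (n d : nat) : seq 'X_{1..n} :=
  [seq s2m t | t : d.-tuple 'I_n <- enum (basis n d)].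

Lemma mem_monomials (n d : nat) (m : 'X_{1..n}) :
  (m \in monomials n d) = (mdeg m == d).
Proof. by rewrite basis_cover. Qed.

Lemma size_monomials (n d : nat) :
  (0 < n)%N -> size (monomials n d) = 'C(n - 1 + d, d).
Proof. by case: n => // n _; rewrite size_basis subn1 addnC. Qed.

Lemma uniq_monomials (n d : nat) : uniq (monomials n d).
Proof. exact: uniq_basis. Qed.

Lemma mdeg_gt0_exists (n : nat) (u : 'X_{1..n}) :
  (0 < mdeg u)%N -> exists k, (U_(k) <= u)%MM.
Proof.
rewrite lt0n mdegE => u0; suff /existsP[k uk] : [exists k, u k != 0%N].
  by exists k; rewrite lep1mP.
rewrite -negb_forall; apply: contra u0 => /forallP u0.
by rewrite big1 // => i _; apply/eqP.
Qed.

Lemma mcoeffMX_sub (K : nzRingType) (n : nat) (p : {mpoly K[n]}) (u m : 'X_{1..n}) :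
  (p * 'X_[u])@_m = if (u <= m)%MM then p@_(m - u) else 0.
Proof.
case: ifPn => [um|]; first by rewrite -{1}(submK um) addmC mcoeffMX.
move=> uNm; apply: memN_msupp_eq0; apply: contra uNm.
by rewrite (perm_mem (msuppMX _ _)) => /mapP[m' _ ->]; rewrite lem_addr.
Qed.

(** Expanding the last factor writes a multinomial coefficient as a sum of [n] nonnegative ones of
    the previous power. Each is at most [n ^ d], and in the right degree some variable divides [m],
    giving a term that is at least 1. *)
Lemma mcoeff_sumXU_exp (K : numDomainType) (n d : nat) (m : 'X_{1..n}) :
  let c := ((\sum_(k < n) 'X_k) ^+ d : {mpoly K[n]})@_m in
  (mdeg m == d)%:R <= c <= (n ^ d)%:R.
Proof.
elim: d m => [|d IHd] m /=.
  by rewrite expr0 mcoeff1 -mdeg_eq0 lexx ler_nat leq_b1.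
rewrite exprSr mulr_sumr raddf_sum /=.
have term_ge0 (k : 'I_n) :
    0 <= ((\sum_(k < n) 'X_k) ^+ d * 'X_k : {mpoly K[n]})@_m <= (n ^ d)%:R.
  rewrite mcoeffMX_sub; case: ifP => _; last by rewrite lexx ler0n.
  by have /andP[c0 ->] := IHd (m - U_(k))%MM; rewrite (le_trans _ c0).
apply/andP; split; last first.
  have -> : (n ^ d.+1)%:R = \sum_(k < n) (n ^ d)%:R :> K.
    by rewrite sumr_const card_ord -[RHS]mulr_natl expnS natrM.
  by apply: ler_sum => k _; have /andP[] := term_ge0 k.
case: eqP => [md|_]; last by apply: sumr_ge0 => k _; have /andP[] := term_ge0 k.
have [k mk] : exists k, (U_(k) <= m)%MM by apply: mdeg_gt0_exists; rewrite md.
rewrite (bigD1 k) //= -[1]addr0 lerD //; last first.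
  by apply: sumr_ge0 => j _; have /andP[] := term_ge0 j.
rewrite mcoeffMX_sub mk.
have /andP[+ _] := IHd (m - U_(k))%MM.
suff -> : mdeg (m - U_(k)) == d by [].
rewrite -(eqn_add2r 1) -{1}(mdeg1 k) -mdegD submK // md.
by rewrite addn1.
Qed.

Lemma dhomogE_monomials (K : nzRingType) (n d : nat) (p : {mpoly K[n]}) :
  p \is d.-homog -> p = \sum_(m <- monomials n d) p@_m *: 'X_[m].
Proof.
move=> ph; apply/mpolyP => m; rewrite raddf_sum /=.
have [mm|mNm] := boolP (m \in monomials n d).
  rewrite (bigD1_seq m) ?uniq_monomials //= mcoeffZ mcoeffX eqxx mulr1.
  rewrite big1 ?addr0 // => m' m'm.
  by rewrite mcoeffZ mcoeffX (negPf m'm) mulr0.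
rewrite (dhomog_nemf_coeff ph) -?mem_monomials // big_seq big1 // => m' m'm.
rewrite mcoeffZ mcoeffX; case: eqP => [m'E|]; last by rewrite mulr0.
by rewrite -m'E m'm in mNm.
Qed.

Lemma sumXU_exp_homog (K : nzRingType) (n d : nat) :
  ((\sum_(k < n) 'X_k) ^+ d : {mpoly K[n]}) \is d.-homog.
Proof.
rewrite -{2}[d]mul1n; apply: dhomogMn; apply: rpred_sum => k _.
by rewrite dhomogX; apply/eqP/mdeg1.
Qed.

(** * Squared moduli and the upper bound on the signature ratio *)

Lemma meval_normsqX (C : numDomainType) (n : nat) (m : 'X_{1..n}) (z : 'I_n -> C) :
  ('X_[m] : {mpoly C[n]}).@[fun k => `|z k| ^+ 2] = `|'X_[m].@[z]| ^+ 2.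
Proof.
rewrite !mevalX normr_prod -prodrXl; apply: eq_bigr => k _.
by rewrite normrX -!exprM mulnC.
Qed.

Lemma heval_normsq_exp (R : realType) (n d : nat) (z : 'I_n -> R[i]) :
  heval (normsq R n ^+ d) z =
  ((\sum_(k < n) 'X_k) ^+ d : {mpoly R[i][n]}).@[fun k => `|z k| ^+ 2].
Proof.
rewrite /heval !rmorphXn /= -/(heval _ z) heval_normsq; congr (_ ^+ _).
by rewrite meval_sum; apply: eq_bigr => k _; rewrite mevalXU.
Qed.

(** The form without division also covers [Np = 0], where it forces [Nm = 0]. *)
Lemma signature_bound (R : realType) (n d : nat) (r : {mpoly R[i][n + n]})
    (Np Nm : nat) :
  (0 < n)%N -> squared_norm (r * normsq R n ^+ d) -> signature_pair r Np Nm ->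
  (Np + Nm <= Np * 'C(n - 1 + d, d))%N.
Proof.
move=> n0 [N [h hE]] [f [g [fg_free rE]]].
rewrite -size_monomials //; set s := monomials n d.
pose S : {mpoly R[i][n]} := (\sum_(k < n) 'X_k) ^+ d.
pose mon (t : 'I_(size s)) := nth 0%MM s t.
(* The square roots of the multinomial coefficients make the [|M t|^2] add up to the power of the
   squared norm. *)
pose M t : {mpoly R[i][n]} := sqrtC S@_(mon t) *: 'X_[mon t].
have monP t : mdeg (mon t) = d by apply/eqP; rewrite -mem_monomials mem_nth.
have S1 t : 1 <= S@_(mon t).
  by have /andP[] := mcoeff_sumXU_exp R[i] d (mon t); rewrite monP eqxx.
have SE z : heval (normsq R n ^+ d) z = \sum_t `|(M t).@[z]| ^+ 2.
  rewrite heval_normsq_exp (dhomogE_monomials (sumXU_exp_homog _ _ _)).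
  rewrite meval_sum (big_nth 0%MM) big_mkord; apply: eq_bigr => t _.
  rewrite mevalZ meval_normsqX mevalZ normrM exprMn; congr (_ * _).
  rewrite -normrX sqrtCK ger0_norm //.
  exact: le_trans (S1 t).
(* Moving the negative part of [r] across yields an equality of two sums of squares: the products
   with [f] against those with [g] together with [h]. *)
pose F (it : 'I_Np * 'I_(size s)) := f it.1 * M it.2.
pose G (x : ('I_Nm * 'I_(size s)) + 'I_N) :=
  match x with inl jt => g jt.1 * M jt.2 | inr j => h j end.
have FG z : \sum_it `|(F it).@[z]| ^+ 2 = \sum_x `|(G x).@[z]| ^+ 2.
  have tensor (L : finType) (e : L -> {mpoly R[i][n]}) :
      \sum_(lt : L * 'I_(size s)) `|(e lt.1 * M lt.2).@[z]| ^+ 2 =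
      (\sum_l `|(e l).@[z]| ^+ 2) * heval (normsq R n ^+ d) z.
    rewrite SE big_distrlr /= pair_bigA; apply: eq_bigr => lt _.
    by rewrite mevalM normrM exprMn.
  rewrite big_sumType /= !tensor -hE /heval mevalM -!/(heval _ z) rE mulrBl.
  by rewrite addrC subrK.
have Gspan := sum_normsq_span FG.
have t0 : 'I_(size s).
  by exists 0%N; rewrite size_monomials // bin_gt0 leq_addl.
have M0 : M t0 != 0.
  rewrite scaler_eq0 sqrtC_eq0 -msupp_eq0 msuppX orbF.
  by rewrite gt_eqF // (lt_le_trans ltr01).
(* Multiplication by one fixed nonzero [M t0] preserves independence. The products with [f] are
   themselves members of [F], and those with [g] lie in the span of [F] by [Gspan]. *)
pose v (x : 'I_Np + 'I_Nm) := match x with inl i => f i | inr j => g j end * M t0.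
have v_free : lin_indep v.
  move=> a /eqP; under eq_bigr do rewrite scalerAl.
  by rewrite -mulr_suml mulf_eq0 (negPf M0) orbF => /eqP /fg_free.
have := lin_indep_card (w := F) v_free; rewrite card_sum card_prod !card_ord.
apply=> -[i|j]; last exact: Gspan (inl (j, t0)).
exists (fun it => (it == (i, t0))%:R); rewrite (bigD1 (i, t0)) //= eqxx scale1r.
by rewrite big1 ?addr0 // => it /negPf ->; rewrite scale0r.
Qed.

Lemma signature_ratio_le (R : realType) (n d : nat) (r : {mpoly R[i][n + n]})
    (Np Nm : nat) :
  (0 < n)%N -> r != 0 -> squared_norm (r * normsq R n ^+ d) ->
  signature_pair r Np Nm ->
  (0 < Np)%N /\ (Nm%:R / Np%:R : R) <= 'C(n - 1 + d, d)%:R - 1.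
Proof.
move=> n0 rN0 rs sp; have le_N := signature_bound n0 rs sp.
(* Without positive squares there are no negative ones either, and [r] would vanish at every
   point. *)
have Np0 : (0 < Np)%N.
  rewrite lt0n; apply: contra rN0 => /eqP E.
  move: le_N sp; rewrite E mul0n add0n leqn0 => /eqP -> [f [g [_ rE]]].
  by apply/eqP/heval_eq0 => z; rewrite rE !big_ord0 subr0.
split=> //; rewrite ler_pdivrMr ?ltr0n // mulrBl mul1r lerBrDr -natrM -natrD.
by rewrite ler_nat addnC mulnC.
Qed.

(** * Diagonal forms *)

(** Reading off the coefficient at [w i] isolates [a i * c i]. *)
Lemma lin_indep_monomials (K : fieldType) (n : nat) (I : finType)
    (v : I -> {mpoly K[n]}) (c : I -> K) (w : I -> 'X_{1..n}) :
  injective w -> (forall i, c i != 0) -> (forall i, v i = c i *: 'X_[w i]) ->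
  lin_indep v.
Proof.
move=> w_inj c0 vE a /(congr1 (mcoeff (w _))) va i; move: (va i).
rewrite mcoeff0 raddf_sum (bigD1 i) //= big1 ?addr0 => [|j ji].
  rewrite vE !mcoeffZ mcoeffX eqxx mulr1 => /eqP.
  by rewrite mulf_eq0 (negPf (c0 i)) orbF => /eqP.
by rewrite vE !mcoeffZ mcoeffX (inj_eq w_inj) (negPf ji) !mulr0.
Qed.

(** The exponent of [|z^m|^2], that is, the diagonal position (m, m) of the coefficient matrix. *)
Definition mdouble (n : nat) (m : 'X_{1..n}) : 'X_{1..n + n} :=
  [multinom match split i with inl k => m k | inr k => m k end | i < n + n].

Lemma mdouble_lshift (n : nat) (m : 'X_{1..n}) k : mdouble m (lshift n k) = m k.
Proof. by rewrite mnmE (unsplitK (inl k)). Qed.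

Lemma mdouble_rshift (n : nat) (m : 'X_{1..n}) k : mdouble m (rshift n k) = m k.
Proof. by rewrite mnmE (unsplitK (inr k)). Qed.

Lemma mdouble_inj (n : nat) : injective (@mdouble n).
Proof.
by move=> m m' E; apply/mnmP => k; rewrite -mdouble_lshift E mdouble_lshift.
Qed.

Lemma heval_mdouble (R : realType) (n : nat) (m : 'X_{1..n}) (z : 'I_n -> R[i]) :
  heval 'X_[mdouble m] z = ('X_[m] : {mpoly R[i][n]}).@[fun k => `|z k| ^+ 2].
Proof.
rewrite /heval !mevalX big_split_ord /= -big_split; apply: eq_bigr => k _ /=.
rewrite mdouble_lshift mdouble_rshift -exprMn /zzbar normCK.
by rewrite (unsplitK (inl k)) (unsplitK (inr k)).
Qed.

(** Each term with coefficient c is the squared modulus of sqrt(c) z^m. *)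
Lemma nonneg_coef_squared_norm (R : realType) (n : nat)
    (p : {mpoly R[i][n + n]}) (Q : {mpoly R[i][n]}) :
  (forall m, 0 <= Q@_m) ->
  (forall z, heval p z = Q.@[fun k => `|z k| ^+ 2]) -> squared_norm p.
Proof.
move=> Q0 pQ; exists (size (msupp Q)).
exists (fun j => sqrtC Q@_(nth 0%MM (msupp Q) j) *: 'X_[nth 0%MM (msupp Q) j]).
move=> z; rewrite pQ {1}(mpolyE Q) meval_sum (big_nth 0%MM) big_mkord.
apply: eq_bigr => j _; rewrite mevalZ meval_normsqX mevalZ normrM exprMn.
congr (_ * _).
by rewrite -normrX sqrtCK ger0_norm.
Qed.

(** * Signature pair of the diagonal form attached to a covering set of monomials *)

Section Covering.

Variables (R : realType) (n d m : nat) (P : pred 'X_{1..n}).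
Hypothesis n_gt0 : (0 < n)%N.
Hypothesis covering : forall u : 'X_{1..n}, mdeg u = (m + d)%N ->
  exists a, [/\ P a, mdeg a = m & (a <= u)%MM].

Let A := filter P (monomials n m).

Let B := filter (predC P) (monomials n m).

(** Each of the [size B] negative monomials contributes at most [n ^ d] to a coefficient of the
    product, so this weight keeps their total at most 1. The successor keeps the denominator
    positive when [B] is empty. *)
Let e : R[i] := ((size B * n ^ d).+1%:R)^-1.

Let e_gt0 : 0 < e. Proof. by rewrite invr_gt0 ltr0Sn. Qed.

Let r : {mpoly R[i][n + n]} :=
  \sum_(a <- A) 'X_[mdouble a] - e *: \sum_(b <- B) 'X_[mdouble b].

Let memA a : (a \in A) = P a && (mdeg a == m).
Proof. by rewrite mem_filter mem_monomials. Qed.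

Let memB b : (b \in B) = ~~ P b && (mdeg b == m).
Proof. by rewrite mem_filter mem_monomials. Qed.

Let hevalE z : heval r z =
  (\sum_(a <- A) 'X_[a] - e *: \sum_(b <- B) 'X_[b] : {mpoly R[i][n]}).@[
    fun k => `|z k| ^+ 2].
Proof.
rewrite /r /heval !mevalB !mevalZ !meval_sum.
by congr (_ - _ * _); apply: eq_bigr => a _; rewrite -heval_mdouble.
Qed.

(** In degree [m + d], an element of [A] dividing [u] contributes at least 1, which outweighs the
    negative part scaled by [e]. In other degrees homogeneity makes the coefficient zero. *)
Let cover_coef_ge0 u :
  0 <= ((\sum_(a <- A) 'X_[a] - e *: \sum_(b <- B) 'X_[b])
          * (\sum_(k < n) 'X_k) ^+ d : {mpoly R[i][n]})@_u.
Proof.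
set S := (\sum_(k < n) 'X_k) ^+ d.
have S_ge0 v : 0 <= S@_v.
  have /andP[+ _] := mcoeff_sumXU_exp R[i] d v.
  by apply: le_trans; rewrite ler0n.
have homogA (s : seq 'X_{1..n}) : {subset s <= monomials n m} ->
    (\sum_(a <- s) 'X_[a] : {mpoly R[i][n]}) \is m.-homog.
  move=> sm; rewrite big_seq; apply: rpred_sum => a /sm.
  by rewrite mem_monomials dhomogX.
have [ud|] := eqVneq (mdeg u) (m + d)%N; last first.
  move=> uN; rewrite (dhomog_nemf_coeff (d := (m + d)%N) _ uN) //.
  apply: dhomogM; last exact: sumXU_exp_homog.
  by rewrite rpredB ?rpredZ //; apply: homogA => a; rewrite mem_filter => /andP[].
have coefX v : 0 <= ('X_[v] * S)@_u <= (n ^ d)%:R.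
  rewrite mulrC mcoeffMX_sub; case: ifP => _; last by rewrite lexx ler0n.
  by rewrite S_ge0; have /andP[] := mcoeff_sumXU_exp R[i] d (u - v)%MM.
rewrite mulrBl mcoeffB subr_ge0 -scalerAl mcoeffZ.
apply: (@le_trans _ _ 1).
  rewrite ler_pdivrMl ?ltr0Sn // mulr1 mulr_suml raddf_sum /=.
  apply: (@le_trans _ _ (\sum_(b <- B) (n ^ d)%:R)).
    by apply: ler_sum => b _; have /andP[] := coefX b.
  by rewrite big_const_seq count_predT iter_addr_0 -mulrnA ler_nat mulnC leqnSn.
have [a [Pa am au]] := covering ud.
have aA : a \in A by rewrite memA Pa am eqxx.
rewrite mulr_suml raddf_sum (big_rem a) //= -[1]addr0 lerD //; last first.
  by apply: sumr_ge0 => b _; have /andP[] := coefX b.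
rewrite mulrC mcoeffMX_sub au.
have /andP[+ _] := mcoeff_sumXU_exp R[i] d (u - a)%MM.
suff -> : mdeg (u - a) == d by [].
by rewrite -(eqn_add2r (mdeg a)) -mdegD submK // ud am addnC.
Qed.

Lemma covering_signature :
  exists r0 : {mpoly R[i][n + n]},
    [/\ Psi d r0, r0 != 0,
        signature_pair r0 (count P (monomials n m)) (count (predC P) (monomials n m))
      & (0 < count P (monomials n m))%N].
Proof.
(* Covering a single pure power of degree [m + d] already shows that [A] is nonempty. *)
have [a0 [Pa0 a0m _]] : exists a, [/\ P a, mdeg a = m
    & (a <= U_(Ordinal n_gt0) *+ (m + d))%MM].
  by apply: covering; rewrite mdegMn mdeg1 mul1n.
have a0A : a0 \in A by rewrite memA Pa0 a0m eqxx.
exists r; rewrite -!size_filter -/A -/B; split.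
- split=> [z||].
  + rewrite hevalE mevalB mevalZ !meval_sum.
    rewrite rpredB ?rpredM ?rpred_sum ?(ger0_real (ltW e_gt0)) // => a _;
      by rewrite meval_normsqX ger0_real ?exprn_ge0.
  + exists m => ab; have [/mapP[a aAB ->] _|abN] :=
        boolP (ab \in [seq mdouble a | a <- A ++ B]).
      have am : mdeg a = m.
        by move: aAB; rewrite mem_cat memA memB => /orP[] /andP[_ /eqP].
      by split; rewrite -am mdegE; apply: eq_bigr => k _;
        rewrite ?mdouble_lshift ?mdouble_rshift.
    suff rab0 : r@_ab = 0 by rewrite mcoeff_msupp rab0 eqxx.
    rewrite mcoeffB mcoeffZ !raddf_sum /=.
    move: abN; rewrite map_cat mem_cat negb_or => /andP[abA abB].
    rewrite !big_seq !big1 ?mulr0 ?subr0 // => a aI; rewrite mcoeffX;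
      case: eqP => // aE.
    + by rewrite -aE map_f in abB.
    by rewrite -aE map_f in abA.
  + apply: (@nonneg_coef_squared_norm _ _ _ _ cover_coef_ge0) => z.
    by rewrite mevalM -hevalE -heval_normsq_exp /heval mevalM.
(* The coefficient at [mdouble a0] is 1: [A] has no repetition, and [P] keeps [a0] out of [B]. *)
- apply/eqP => /(congr1 (mcoeff (mdouble a0))) /eqP.
  rewrite mcoeff0 mcoeffB mcoeffZ !raddf_sum /=.
  rewrite (bigD1_seq a0) ?filter_uniq ?uniq_monomials //= mcoeffX eqxx.
  rewrite !big1_seq ?addr0 ?mulr0 ?subr0 ?oner_eq0 // => a.
    move=> /andP[_]; rewrite memB => /andP[PNa _]; rewrite mcoeffX.
    by rewrite (inj_eq (@mdouble_inj _)); case: eqP => // aE; rewrite aE Pa0 in PNa.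
  by move=> /andP[aa0 _]; rewrite mcoeffX (inj_eq (@mdouble_inj _)) (negPf aa0).
- exists (fun i => 'X_[nth 0%MM A i]).
  exists (fun j => sqrtC e *: 'X_[nth 0%MM B j]); split.
    (* [P] separates [A] from [B], so both families together are nonzero multiples of distinct
       monomials. *)
    pose w (x : 'I_(size A) + 'I_(size B)) :=
      match x with inl i => nth 0%MM A i | inr j => nth 0%MM B j end.
    pose c (x : 'I_(size A) + 'I_(size B)) := if x is inl _ then 1 else sqrtC e.
    have PA (i : 'I_(size A)) : P (nth 0%MM A i).
      by have := mem_nth 0%MM (ltn_ord i); rewrite memA => /andP[].
    have PB (j : 'I_(size B)) : ~~ P (nth 0%MM B j).
      by have := mem_nth 0%MM (ltn_ord j); rewrite memB => /andP[].
    apply: (@lin_indep_monomials _ _ _ _ c w).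
    + move=> [i|j] [i'|j'] /= /eqP; rewrite ?nth_uniq ?filter_uniq ?uniq_monomials //.
      * by move=> /eqP/val_inj ->.
      * by move=> /eqP E; have := PB j'; rewrite -E PA.
      * by move=> /eqP E; have := PB j; rewrite E PA.
      by move=> /eqP/val_inj ->.
    + by case=> [i|j] /=; rewrite ?oner_eq0 // sqrtC_eq0 gt_eqF.
    by case=> [i|j] /=; rewrite ?scale1r.
  move=> z; rewrite hevalE mevalB mevalZ !meval_sum mulr_sumr.
  rewrite !(big_nth 0%MM) !big_mkord; congr (_ - _); apply: eq_bigr => j _.
    exact: meval_normsqX.
  rewrite meval_normsqX mevalZ normrM exprMn; congr (_ * _).
  by rewrite -normrX sqrtCK gtr0_norm.
by rewrite lt0n size_eq0; apply: contraL a0A => /eqP ->.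
Qed.

End Covering.

(** * Covering sets: pure powers and even exponents *)

(** The divisor grows by one variable at a time, taken from the quotient [u - a] while that has
    positive degree. *)
Lemma submonomial_deg (n k : nat) (u : 'X_{1..n}) :
  (k <= mdeg u)%N -> exists2 a, mdeg a = k & (a <= u)%MM.
Proof.
elim: k => [|k IHk] ku.
  by exists 0%MM; rewrite ?mdeg0 //; apply/mnm_lepP => i; rewrite mnm0E.
have [a ak au] := IHk (ltnW ku).
have [l lu] : exists l, (U_(l) <= u - a)%MM.
  by apply: mdeg_gt0_exists; have := mdegD (u - a) a; rewrite submK // ak; lia.
exists (a + U_(l))%MM; first by rewrite mdegD ak mdeg1 addn1.
apply/mnm_lepP => i; have := mnm_lepP lu i; have := mnm_lepP au i.
by rewrite mnmBE mnmDE; lia.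
Qed.

(* Pigeonhole: [n * (q - 1) < q + d]. *)
Lemma pure_power_covering (n q d : nat) (u : 'X_{1..n}) :
  (0 < q)%N -> (n * q.-1 <= d)%N -> mdeg u = (q + d)%N ->
  exists a : 'X_{1..n},
    [/\ [exists k, q <= a k]%N, mdeg a = q & (a <= u)%MM].
Proof.
move=> q0 nqd ud; have /existsP[k qk] : [exists k, q <= u k]%N.
  rewrite -[[exists _, _]]negbK negb_exists; apply/negP => /forallP uq.
  suff : (mdeg u <= n * q.-1)%N.
    by rewrite ud leqNgt (leq_ltn_trans nqd) // -{1}[d]add0n ltn_add2r.
  have -> : (n * q.-1 = \sum_(k < n) q.-1)%N by rewrite sum_nat_const card_ord.
  rewrite mdegE; apply: leq_sum => k _.
  by rewrite -ltnS prednK // ltnNge uq.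
exists (U_(k) *+ q)%MM; split; rewrite ?mdegMn ?mdeg1 ?mul1n //.
  by apply/existsP; exists k; rewrite mulmnE mnm1E eqxx mul1n.
by apply/mnm_lepP => j; rewrite mulmnE mnm1E; case: eqP => [<-|_]; rewrite ?mul1n.
Qed.

(** In degree [q], an exponent of at least [q] exhausts the degree, so only the pure powers of the
    [n] variables remain. *)
Lemma count_pure_powers (n q : nat) :
  (count (fun a : 'X_{1..n} => [exists k, q <= a k]) (monomials n q) <= n)%N.
Proof.
have sn : size [seq (U_(k) *+ q)%MM | k <- enum 'I_n] = n.
  by rewrite size_map size_enum_ord.
rewrite -size_filter -[X in (_ <= X)%N]sn.
apply: uniq_leq_size; rewrite ?filter_uniq ?uniq_monomials // => a.
rewrite mem_filter mem_monomials => /andP[/existsP[k qk] /eqP aq].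
apply/mapP; exists k; rewrite ?mem_enum //.
have le_a : (U_(k) *+ q <= a)%MM.
  by apply/mnm_lepP => j; rewrite mulmnE mnm1E; case: eqP => [<-|_]; rewrite ?mul1n.
have : mdeg (a - U_(k) *+ q) == 0%N.
  have := mdegD (a - U_(k) *+ q) (U_(k) *+ q).
  by rewrite submK // aq mdegMn mdeg1; lia.
by rewrite mdeg_eq0 => /eqP E; rewrite -(submK le_a) E add0m.
Qed.

(** Either the square of variable [i] divides [u], or deleting that variable costs at most one
    degree. What is left then has degree at least [1 + d], hence at least 2, and contains a
    quadratic monomial with exponent 0 at [i]. *)
Lemma even_exponent_covering (n d : nat) (i : 'I_n) (u : 'X_{1..n}) :
  (0 < d)%N -> mdeg u = (2 + d)%N ->
  exists a : 'X_{1..n}, [/\ ~~ odd (a i), mdeg a = 2%N & (a <= u)%MM].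
Proof.
move=> d0 ud; have [ui|ui] := leqP 2 (u i).
  exists (U_(i) *+ 2)%MM; rewrite mdegMn mdeg1 mulmnE mnm1E eqxx; split=> //.
  by apply/mnm_lepP => j; rewrite mulmnE mnm1E; case: eqP => [<-|_].
pose v := (u - U_(i) *+ u i)%MM.
have le_u : (U_(i) *+ u i <= u)%MM.
  by apply/mnm_lepP => j; rewrite mulmnE mnm1E; case: eqP => [<-|_]; rewrite ?mul1n.
have [|a a2 av] := @submonomial_deg _ 2 v.
  have := mdegD v (U_(i) *+ u i); rewrite submK // ud mdegMn mdeg1; lia.
exists a; split=> //; last exact: lepm_trans av (lem_subr _ _).
have /mnm_lepP/(_ i) := av.
by rewrite mnmBE mulmnE mnm1E eqxx mul1n subnn leqn0 => /eqP ->.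
Qed.

(** * Growth of the signature ratio in [d] *)

(** The right side is the product of the [N] factors from q + 1 to q + N. *)
Lemma leq_expn_bin (q N : nat) : (q.+1 ^ N <= 'C(N + q, q) * N`!)%N.
Proof.
rewrite -bin_sub ?leq_addl // addnK bin_ffact ffact_prod.
have -> : (q.+1 ^ N = \prod_(i < N) q.+1)%N by rewrite prod_nat_const card_ord.
by apply: leq_prod => i _; have := ltn_ord i; lia.
Qed.

(* For [d < n] the exponent [q] below would be [1] and leave nothing to
   subtract, so degree two with one exponent even takes over. *)
Lemma large_signature_ratio (R : realType) (n d : nat) :
  (2 <= n)%N -> (1 <= d)%N ->
  exists (r : {mpoly R[i][n + n]}) (Np Nm : nat),
    [/\ Psi d r, r != 0, signature_pair r Np Nm, (0 < Np)%N
      & (d ^ (n - 1) * Np <= 3 * n`! * n ^ (n - 1) * n ^ 2 * Nm)%N].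
Proof.
move=> n2 d1; have n0 : (0 < n)%N := ltnW n2.
have C2 : (2 * 'C(n - 1 + 2, 2) = n.+1 * n)%N.
  have := bin_ffact (n - 1 + 2) 2; rewrite ffactnS ffactn1 mulnC => ->.
  by congr (_ * _)%N; lia.
have [nd|dn] := leqP n d.
  (* The largest [q] with n (q - 1) <= d; the assumption [n <= d] makes it at least 2. *)
  pose q := (d %/ n).+1.
  have q2 : (2 <= q)%N by rewrite ltnS divn_gt0.
  have nqd : (n * q.-1 <= d)%N by rewrite mulnC leq_trunc_div.
  pose P (a : 'X_{1..n}) := [exists k, q <= a k]%N.
  have [||r [rPsi r0 rs rp]] := @covering_signature R n d q P => //.
    by move=> u; apply: pure_power_covering.
  exists r, (count P (monomials n q)), (count (predC P) (monomials n q)).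
  split=> //; have Np_le : (count P (monomials n q) <= n)%N := count_pure_powers n q.
  have := count_predC P (monomials n q); rewrite size_monomials //.
  set Np := count P _ in Np_le *; set Nm := count (predC P) _; set T := 'C(_, _).
  (* Since d < q n, the left side is at most ((q + 1) n)^(n - 1), to which [leq_expn_bin]
     applies. *)
  move=> NT; have T_ge : (d ^ (n - 1) <= T * (n - 1)`! * n ^ (n - 1))%N.
    apply: leq_trans (leq_mul (leq_expn_bin q (n - 1)) (leqnn _)).
    rewrite -expnMn leq_exp2r ?subn_gt0 //.
    by rewrite (leq_trans (ltnW (ltn_ceil d n0))) // leq_mul2r leqnSn orbT.
  (* As q >= 2 and n >= 2, [T] is at least n (n + 1) / 2 >= 3 n / 2. Removing at most [n] pure
     powers thus leaves at least a third of [T], whence the factor 3 in the constant. *)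
  have T_ge3 : (3 * n <= 2 * T)%N.
    suff : ('C(n - 1 + 2, 2) <= T)%N by move: C2 n2; nia.
    rewrite /T -(bin_sub (leq_addl _ 2)) -(bin_sub (leq_addl _ q)) !addnK.
    by apply: leq_bin2l; rewrite leq_add2l.
  have Nm_ge : (T <= 3 * Nm)%N by lia.
  have fact_n : n`! = (n * (n - 1)`!)%N by rewrite -{1 2}(subnK n0) addn1.
  apply: leq_trans (leq_mul T_ge Np_le) _.
  have T_le := leq_mul (leq_mul Nm_ge (leqnn (n - 1)`!)) (leqnn (n ^ (n - 1))).
  apply: leq_trans (leq_mul T_le (leqnn n)) _.
  rewrite fact_n; set X := (n ^ (n - 1))%N; set Y := (n - 1)`!.
  have -> : (3 * Nm * Y * X * n = 3 * (n * Y) * X * 1 * Nm)%N by lia.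
  by rewrite leq_mul // leq_mul // expn_gt0 n0.
(* For [d < n] the power of [d] is below a constant, so one negative square is enough: the product
   of the first two variables has odd exponent at [i0]. *)
pose i0 := Ordinal n0; pose i1 := Ordinal n2.
pose P (a : 'X_{1..n}) := ~~ odd (a i0).
have [||r [rPsi r0 rs rp]] := @covering_signature R n d 2 P => //.
  by move=> u; apply: even_exponent_covering.
exists r, (count P (monomials n 2)), (count (predC P) (monomials n 2)).
split=> //; have Nm_ge1 : (0 < count (predC P) (monomials n 2))%N.
  rewrite -has_count; apply/hasP; exists (U_(i0) + U_(i1))%MM.
    by rewrite mem_monomials mdegD !mdeg1.
  by rewrite /= /P mnmDE !mnm1E.
(* All n (n + 1) / 2 quadratic monomials number at most n^2, whence the factor [n ^ 2] in the
   constant. *)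
have Np_le : (count P (monomials n 2) <= n ^ 2)%N.
  apply: leq_trans (count_size _ _) _; rewrite size_monomials //.
  by have := n2; move: C2; nia.
rewrite -[X in (X <= _)%N]muln1 leq_mul //.
apply: leq_mul => //; rewrite -[X in (X <= _)%N]mul1n.
by rewrite leq_mul ?muln_gt0 ?fact_gt0 // leq_exp2r ?subn_gt0 // ltnW.
Qed.

Theorem theorem1p3 (R : realType) :
  (forall (n d : nat) (r : {mpoly R[i][n + n]}) (Np Nm : nat),
     (2 <= n)%N -> (1 <= d)%N ->
     real_poly r -> r != 0 ->
     squared_norm (r * normsq R n ^+ d) ->
     signature_pair r Np Nm ->
     (0 < Np)%N /\
     (Nm%:R / Np%:R : R) <= 'C(n - 1 + d, d)%:R - 1)
  /\
  (forall n : nat, (2 <= n)%N ->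
     exists C : R, 0 < C /\
       forall d : nat, (1 <= d)%N ->
         exists (r : {mpoly R[i][n + n]}) (Np Nm : nat),
           [/\ Psi d r, r != 0, signature_pair r Np Nm, (0 < Np)%N
             & C * d%:R ^+ (n - 1) <= (Nm%:R / Np%:R : R)]).
Proof.
split=> [n d r Np Nm n2 _ _|n n2].
  exact: signature_ratio_le (ltnW n2).
pose K := (3 * n`! * n ^ (n - 1) * n ^ 2)%N.
have K0 : (0 < K)%N by rewrite !muln_gt0 fact_gt0 !expn_gt0 (ltnW n2).
exists K%:R^-1; split=> [|d d1]; first by rewrite invr_gt0 ltr0n.
have [r [Np [Nm [rPsi r0 rs Np0 ratio]]]] := large_signature_ratio R n2 d1.
exists r, Np, Nm; split=> //.
by rewrite ler_pdivlMr ?ltr0n // -mulrA ler_pdivrMl ?ltr0n // -natrX -!natrM ler_nat.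
Qed.
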